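(* For every $n\ge 1$ there exists a unique involution $\xi:\mathfrak L_n\to\mathfrak L_n$ such that, whenever $W=(w,h,c)\in\mathfrak L_n$ with $\mathrm{cs}(W)=m$ and $V=\xi(W)=(v,g,b)$, the following hold: (1) $\mathrm{cs}(V)=n+1-m$. (2) For every $j\in[n]$ with $j\neq n+1-m$: $v_j\in\{\mathrm N,\mathrm E\}$ if and only if $w_{n+1-j}\in\{\mathrm S,\mathrm{dE}\}$. (3) For every $j\in[n]$: $g_j=h_{n+1-j}+1$ if $j>n+1-m$ and $v_j\in\{\mathrm S,\mathrm{dE}\}$; $g_j=h_{n+1-j}-1$ if $j<n+1-m$ and $v_j\in\{\mathrm N,\mathrm E\}$; and $g_j=h_{n+1-j}$ otherwise. (4) For every $j\in[n]$: $b_j=g_j-h_{n+1-j}+c_{n+1-j}$.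
   Context: $[n]=\{1,\dots,n\}$. A 2-Motzkin path of length $n$ is a word $w=w_1\cdots w_n$ over the four-letter alphabet $\{\mathrm N,\mathrm S,\mathrm E,\mathrm{dE}\}$ (northeast, southeast, solid east, dotted east steps) such that, with $h_i:=\#\{j<i: w_j=\mathrm N\}-\#\{j<i: w_j=\mathrm S\}$ for $1\le i\le n+1$, one has $h_i\ge 0$ for all $i$ and $h_{n+1}=0$. An sr-Laguerre history of length $n$ is a triple $W=(w,h,c)$ where $w$ is a 2-Motzkin path of length $n$, $h=h_1\cdots h_n$ is its height sequence just defined, and $c=c_1\cdots c_n$ is a sequence of integers with $0\le c_i\le h_i$ if $w_i\in\{\mathrm N,\mathrm E\}$ and $1\le c_i\le h_i$ if $w_i\in\{\mathrm S,\mathrm{dE}\}$. $\mathfrak L_n$ is the set of sr-Laguerre histories of length $n$. The index of the critical step is $\mathrm{cs}(W):=\max\{i\in[n]: c_i=0\}$ (well defined since $c_1=h_1=0$). *)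

(* Defs.v *)
From HB Require Import structures.
From mathcomp Require Import all_boot all_order all_algebra.

Set Implicit Arguments.
Unset Strict Implicit.
Unset Printing Implicit Defensive.

Import Order.TTheory GRing.Theory Num.Theory.
Local Open Scope ring_scope.

Inductive step := StepN | StepS | StepE | StepdE.

Definition bools_of_step (s : step) : bool * bool :=
  match s with
  | StepN => (true, true)
  | StepS => (true, false)
  | StepE => (false, true)
  | StepdE => (false, false)
  end.

Definition step_of_bools (b : bool * bool) : step :=
  match b with
  | (true, true) => StepN
  | (true, false) => StepS
  | (false, true) => StepE
  | (false, false) => StepdE
  end.

Lemma bools_of_stepK : cancel bools_of_step step_of_bools.
Proof. by case. Qed.

HB.instance Definition _ := Finite.copy step (can_type bools_of_stepK).

(* The height after the first i letters of w: the paper's h_(i+1). *)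
Definition height (w : seq step) (i : nat) : int :=
  (count_mem StepN (take i w))%:Z - (count_mem StepS (take i w))%:Z.

Definition motzkin2 n (w : n.-tuple step) : bool :=
  [forall i : 'I_n.+1, 0 <= height w i] && (height w n == 0).

(* The component h of a history (w, h, c) is a function of w, so only w and c
   are stored.  Letters are indexed by 'I_n, that is from 0: (i : 'I_n) stands
   for the position i.+1 of [n], whose height is height w i. *)
Definition is_laguerre n (wc : n.-tuple step * n.-tuple int) : bool :=
  let: (w, c) := wc in
  motzkin2 w &&
  [forall i : 'I_n,
     ((tnth w i \in [:: StepN; StepE]) ==> (0 <= tnth c i <= height w i)) &&
     ((tnth w i \in [:: StepS; StepdE]) ==> (1 <= tnth c i <= height w i))].

Record laguerre (n : nat) := Laguerre {
  laguerre_val :> n.-tuple step * n.-tuple int;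
  _ : is_laguerre laguerre_val
}.

HB.instance Definition _ n := [isSub for @laguerre_val n].
HB.instance Definition _ n := [Choice of laguerre n by <:].

Definition lstep n (W : laguerre n) (i : 'I_n) : step := tnth W.1 i.
Definition lheight n (W : laguerre n) (i : 'I_n) : int := height W.1 i.
Definition lcol n (W : laguerre n) (i : 'I_n) : int := tnth W.2 i.

(* A position in [n], hence counted from 1. *)
Definition cs n (W : laguerre n) : nat := \max_(i < n | lcol W i == 0) i.+1.

(* Main.v *)
Require Import Defs.
From Stdlib Require Import FunctionalExtensionality.
From mathcomp Require Import all_boot all_order all_algebra.
From mathcomp Require Import zify.
Import Order.TTheory GRing.Theory Num.Theory.
Local Open Scope ring_scope.

(* Call N and E "up" letters, S and dE "down" letters.  A letter is determined
   by being up or down and by whether the height changes, so a history is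
   determined by its heights, its colours and its pattern of up letters; since
   the critical step has colour 0 it must be up, and conditions (1)-(4) leave
   at most one choice for xi(W).  These conditions are moreover symmetric in W
   and V, which makes xi an involution once it exists.  For existence one
   reverses the heights, raises them by 1 at the up letters before the critical
   step, lowers them by 1 at the down letters after it, and checks that the
   resulting increments are in {0,1} at up letters and in {-1,0} at down
   letters. *)

Definition up (s : step) : bool := s \in [:: StepN; StepE].

Lemma downE (s : step) : (s \in [:: StepS; StepdE]) = ~~ up s.
Proof. by case: s. Qed.

(** The first bit of the encoding marks N and S; the second is [up]. *)
Definition moves (s : step) : bool := (bools_of_step s).1.

Definition increment (s : step) : int :=
  if moves s then (if up s then 1 else -1) else 0.

Lemma step_eqP (s t : step) : moves s = moves t -> up s = up t -> s = t.
Proof. by case: s; case: t. Qed.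

Lemma height0 (w : seq step) : height w 0 = 0.
Proof. by rewrite /height take0. Qed.

Lemma heightS (w : seq step) (i : nat) : (i < size w)%N ->
  height w i.+1 = height w i + increment (nth StepE w i).
Proof.
move=> lt_i; rewrite /height (take_nth StepE lt_i) -cats1 !count_cat /=.
by case: (nth _ _ _); rewrite /increment /=; lia.
Qed.

Lemma height_mkseq (n : nat) (f : nat -> step) (g : nat -> int) :
    g 0%N = 0 ->
    (forall j, (j < n)%N -> g j.+1 = g j + increment (f j)) ->
  forall j, (j <= n)%N -> height (mkseq f n) j = g j.
Proof.
move=> g0 gS; elim=> [|j IHj] le_j; first by rewrite height0 g0.
by rewrite heightS ?size_mkseq // nth_mkseq // IHj 1?ltnW // gS.
Qed.

(** The two colour conditions merge because the lower bound, 0 at up letters and 1 at down letters,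
    is [~~ up] read as an integer. *)
Lemma is_laguerreP (n : nat) (w : n.-tuple step) (c : n.-tuple int) :
  reflect [/\ forall i, (i <= n)%N -> 0 <= height w i, height w n = 0
            & forall i, (i < n)%N ->
                (~~ up (nth StepE w i))%:Z <= nth 0 c i <= height w i]
          (is_laguerre (w, c)).
Proof.
apply: (iffP andP) => [[/andP[/forallP hw /eqP hn] /forallP hc]|[hw hn hc]].
  split=> // i lt_i; first exact: hw (Ordinal (lt_i : (i < n.+1)%N)).
  have := hc (Ordinal lt_i); rewrite !(tnth_nth StepE) (tnth_nth 0) /= downE.
  by rewrite -/(up _); case: up => /=; rewrite ?andbT.
split.
  by rewrite /motzkin2 hn eqxx andbT; apply/forallP=> i; apply: hw (ltn_ord i).
apply/forallP=> i; have := hc i (ltn_ord i).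
rewrite !(tnth_nth StepE) (tnth_nth 0) /= downE -/(up _).
by case: up => //= ->.
Qed.

Lemma laguerre_spec {n : nat} (W : laguerre n) :
  [/\ forall i, (i <= n)%N -> 0 <= height W.1 i, height W.1 n = 0
    & forall i, (i < n)%N ->
        (~~ up (nth StepE W.1 i))%:Z <= nth 0 W.2 i <= height W.1 i].
Proof. by case: W => -[w c] /= /is_laguerreP. Qed.

Lemma lheightS {n : nat} (W : laguerre n) (i : nat) : (i < n)%N ->
  height W.1 i.+1 = height W.1 i + increment (nth StepE W.1 i).
Proof. by move=> lt_i; rewrite heightS ?size_tuple. Qed.

Lemma cs_spec {n : nat} (W : laguerre n) : (0 < n)%N ->
  exists2 k : 'I_n, cs W = k.+1 &
    lcol W k = 0 /\ forall i : 'I_n, (k < i)%N -> lcol W i != 0.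
Proof.
move=> n_gt0; have [_ _ hc] := laguerre_spec W.
(* At height 0 a down letter is impossible and the colour must be 0, so the maximum is over a
   nonempty set. *)
have c0 : lcol W (Ordinal n_gt0) == 0.
  have := hc 0%N n_gt0; rewrite /lcol (tnth_nth 0) height0 /=.
  by case: up => /=; lia.
have [|k k0 csE] :=
  eq_bigmax_cond (A := [pred i | lcol W i == 0]) (fun i : 'I_n => i.+1).
  by apply/card_gt0P; exists (Ordinal n_gt0).
exists k => //; split; first exact/eqP.
move=> i lt_ki; apply: contraTN lt_ki => i0; rewrite -leqNgt -ltnS.
by rewrite -csE; apply: (@leq_bigmax_cond 'I_n _ (fun i : 'I_n => i.+1)).
Qed.

Lemma cs_eq {n : nat} (W : laguerre n) (k : 'I_n) :
  lcol W k = 0 -> (forall i : 'I_n, (k < i)%N -> lcol W i != 0) -> cs W = k.+1.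
Proof.
move=> k0 kmax; apply/eqP; rewrite eqn_leq; apply/andP; split.
  by apply/bigmax_leqP => i i0; rewrite ltnS leqNgt; apply: contraTN i0; apply: kmax.
by apply: (@leq_bigmax_cond 'I_n _ (fun i : 'I_n => i.+1)); apply/eqP.
Qed.

Lemma col0_up {n : nat} (W : laguerre n) (i : 'I_n) : lcol W i = 0 -> up (lstep W i).
Proof.
have [_ _ /(_ i (ltn_ord i))] := laguerre_spec W.
rewrite /lcol /lstep (tnth_nth 0) (tnth_nth StepE).
by case: up => //=; lia.
Qed.

(** Consecutive heights reveal whether a letter moves; together with [up] this fixes the letter. *)
Lemma laguerre_eq {n : nat} (V V' : laguerre n) :
    (forall j, up (lstep V j) = up (lstep V' j)) ->
    lheight V =1 lheight V' -> lcol V =1 lcol V' -> V = V'.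
Proof.
move=> eq_up eq_h eq_c.
have hS (U : laguerre n) (j : 'I_n) :
    moves (lstep U j) = (height U.1 j.+1 != lheight U j).
  rewrite lheightS // /lheight /lstep (tnth_nth StepE).
  by rewrite -subr_eq0 addrAC subrr add0r; case: nth.
have eq_hS (j : 'I_n) : height V.1 j.+1 = height V'.1 j.+1.
  have [lt_j|ge_j] := ltnP j.+1 n; first exact: eq_h (Ordinal lt_j).
  (* The height after the last letter lies outside [lheight], but is 0 in both histories. *)
  have -> : j.+1 = n by have := ltn_ord j; lia.
  by have [_ -> _] := laguerre_spec V; have [_ -> _] := laguerre_spec V'.
have eq_step : lstep V =1 lstep V'.
  by move=> j; apply: step_eqP; rewrite // !hS eq_hS eq_h.
apply: val_inj; apply: injective_projections; apply: eq_from_tnth => j.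
  exact: eq_step.
exact: eq_c.
Qed.

(** The conditions on [V = xi W], isolated as a relation so that uniqueness and symmetry concern
    pairs of histories instead of maps. *)
Definition mirror {n : nat} (W V : laguerre n) : Prop :=
  [/\ cs V = (n.+1 - cs W)%N,
      forall j : 'I_n, j.+1 <> (n.+1 - cs W)%N ->
        (lstep V j \in [:: StepN; StepE] <->
         lstep W (rev_ord j) \in [:: StepS; StepdE]),
      forall j : 'I_n, lheight V j =
        if (n.+1 - cs W < j.+1)%N && (lstep V j \in [:: StepS; StepdE])
        then lheight W (rev_ord j) + 1
        else if (j.+1 < n.+1 - cs W)%N && (lstep V j \in [:: StepN; StepE])
        then lheight W (rev_ord j) - 1
        else lheight W (rev_ord j)
    & forall j : 'I_n,
        lcol V j = lheight V j - lheight W (rev_ord j) + lcol W (rev_ord j)].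

(** The condition on letters omits the critical position of [V], but colour 0 forces an up letter
    there; hence [W] alone determines the up pattern of [V]. *)
Lemma mirror_up {n : nat} (W V : laguerre n) (j : 'I_n) :
  (0 < n)%N -> mirror W V ->
  up (lstep V j) = (j.+1 == n.+1 - cs W)%N || ~~ up (lstep W (rev_ord j)).
Proof.
move=> n_gt0 [csV upV _ _]; have [j_crit|j_crit] := eqVneq.
  have [k csVk [k0 _]] := cs_spec V n_gt0.
  rewrite col0_up // (_ : j = k) //; apply: val_inj.
  by apply: succn_inj; rewrite j_crit -csVk.
by have [] := upV j (elimN eqP j_crit); rewrite downE => *; apply/idP/idP.
Qed.

Lemma mirror_uniq {n : nat} (W V V' : laguerre n) :
  (0 < n)%N -> mirror W V -> mirror W V' -> V = V'.
Proof.
move=> n_gt0 WV WV'; have eq_up j : up (lstep V j) = up (lstep V' j).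
  by rewrite (mirror_up _ _ _ n_gt0 WV) (mirror_up _ _ _ n_gt0 WV').
case: WV WV' => _ _ hV cV [_ _ hV' cV'].
have eq_h : lheight V =1 lheight V'.
  by move=> j; rewrite hV hV' !downE -!/(up _) eq_up.
by apply: laguerre_eq => // j; rewrite cV cV' eq_h.
Qed.

(** Away from the critical step, reversal exchanges up with down and before with after, so a height
    raised in one direction is lowered back in the other. *)
Lemma mirror_sym {n : nat} (W V : laguerre n) :
  (0 < n)%N -> mirror W V -> mirror V W.
Proof.
move=> n_gt0 WV; have upV j := mirror_up W V j n_gt0 WV; case: WV => csV _ hV cV.
have [k csW [k0 _]] := cs_spec W n_gt0.
have lt_k := ltn_ord k.
have {}upV (j : 'I_n) : j.+1 <> cs W -> up (lstep V (rev_ord j)) = ~~ up (lstep W j).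
  move=> j_crit; rewrite upV rev_ordK orb_idl // => /eqP /=.
  by have := ltn_ord j; lia.
have csE : (n.+1 - cs V)%N = cs W by lia.
rewrite /mirror csE; split=> // j.
- by move=> j_crit; rewrite downE upV // negbK.
- rewrite hV rev_ordK !downE -!/(up _) csW /=.
  have lt_j := ltn_ord j.
  have [j_crit|j_crit] := eqVneq j.+1 (cs W).
    have [-> ->] : (n.+1 - k.+1 < (n - j.+1).+1)%N = false /\
                   ((n - j.+1).+1 < n.+1 - k.+1)%N = false by lia.
    by rewrite j_crit csW !ltnn.
  rewrite upV ?negbK; last exact/eqP.
  have -> : (n.+1 - k.+1 < (n - j.+1).+1)%N = (j.+1 < k.+1)%N by lia.
  have -> : ((n - j.+1).+1 < n.+1 - k.+1)%N = (k.+1 < j.+1)%N by lia.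
  by case: up; case: ltngtP => /=; lia.
- by have := cV (rev_ord j); rewrite rev_ordK; lia.
Qed.

(** A [sig] type lets the witness be projected to define [xi]. *)
Lemma mirror_exists {n : nat} (W : laguerre n) : (0 < n)%N -> {V | mirror W V}.
Proof.
move=> n_gt0; pose m := cs W.
pose w i := nth StepE W.1 i; pose h i := height W.1 i.
(* The correction to height and colour, indexed by positions of [W]; it vanishes at the critical
   step. *)
pose shift i : int :=
  ((i.+1 < m)%N && up (w i))%:Z - ((m < i.+1)%N && ~~ up (w i))%:Z.
(* The value 0 at [j = n] is the final height of [V]. *)
pose g j : int := if (j < n)%N then h (n - j.+1)%N + shift (n - j.+1)%N else 0.
pose t j := (j.+1 == n.+1 - m)%N || ~~ up (w (n - j.+1)%N).
pose v j := step_of_bools (g j.+1 != g j, t j).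
pose b j : int := shift (n - j.+1)%N + nth 0 W.2 (n - j.+1)%N.
have up_v j : up (v j) = t j by rewrite /v; case: (t j); case: eqP.
have [h_ge0 hn hc] := laguerre_spec W.
have hS i : (i < n)%N ->
    h i - (~~ up (w i))%:Z <= h i.+1 <= h i + (up (w i))%:Z.
  move=> lt_i; rewrite /h lheightS // -/(w i) /increment.
  by case: up; case: moves; lia.
have h0 : h 0%N = 0 := height0 _.
have [m_gt0 m_le] : (0 < m)%N /\ (m <= n)%N.
  by rewrite /m; have [k -> _] := cs_spec W n_gt0.
have [w_crit c_crit] : up (w m.-1) /\ nth 0 W.2 m.-1 = 0.
  rewrite /m /w; have [k -> [k0 _]] := cs_spec W n_gt0.
  have := col0_up W k k0; move: k0; rewrite /lcol /lstep (tnth_nth 0) (tnth_nth StepE).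
  by [].
have c_gt i : (i < n)%N -> (m < i.+1)%N -> 1 <= nth 0 W.2 i.
  move=> lt_i; rewrite /m; have [k -> [_ kmax]] := cs_spec W n_gt0 => lt_ki.
  have := kmax (Ordinal lt_i) lt_ki; rewrite /lcol (tnth_nth 0) /=.
  by have := hc i lt_i; set c := nth _ _ _; case: up => /=; lia.
have g0 : g 0%N = 0.
  rewrite /g n_gt0 subn1 /shift prednK //.
  have lt_n : (n.-1 < n)%N by rewrite prednK.
  have := hS _ lt_n; have := hc _ lt_n; have := h_ge0 _ (ltnW lt_n).
  rewrite -/(h _) -/(w _) prednK // (_ : h n = 0) //.
  (* A critical last letter is up, hence starts at height 0 and is not corrected. After the critical
     step, a last letter starts at 0 if up, and at 1, lowered to 0, if down. *)
  have [eq_m|ne_m] := eqVneq m n; last by case: up => /=; lia.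
  by have := w_crit; rewrite eq_m ltnn => ->; lia.
have gS j : (j < n)%N -> g j.+1 = g j + increment (v j).
  move=> lt_j.
  suff : g j - (~~ t j)%:Z <= g j.+1 <= g j + (t j)%:Z.
    by rewrite /v /increment; case: (t j); case: eqP => /=; lia.
  set i := (n - j.+1)%N; have lt_i : (i < n)%N by rewrite /i; lia.
  rewrite /t -/i /g lt_j -/i.
  have -> : (j.+1 == n.+1 - m)%N = (i.+1 == m) by rewrite /i; lia.
  have [lt_j1|ge_j1] := ltnP j.+1 n; last first.
    (* The last letter of [V] mirrors the first letter of [W], which is up and starts at height
       0. *)
    have i0 : i = 0%N by rewrite /i; lia.
    have := hc 0%N n_gt0; rewrite i0 /shift -/(h _) -/(w _) h0.
    by case: up => /=; lia.
  set i' := (n - j.+2)%N; have lt_i' : (i' < n)%N by rewrite /i'; lia.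
  have ii' : i = i'.+1 by rewrite /i /i'; lia.
  (* The quantity [h i' + shift i' - h i] lies in {0,1} if [i'] is before the critical step and in
     {-1,0} otherwise; subtracting [shift i] yields the range that [t j] prescribes. *)
  have := hS _ lt_i'; rewrite -ii' /shift -ii'.
  have [i_crit|i_crit] := eqVneq i.+1 m.
    by case: (up (w i')); case: (up (w i)) => /=; lia.
  have [i'_crit|i'_crit] := eqVneq i m.
    have -> : up (w i') by rewrite (_ : i' = m.-1) //; lia.
    by case: (up (w i)) => /=; lia.
  by case: (up (w i')); case: (up (w i)) => /=; lia.
have size_v : size (mkseq v n) == n by rewrite size_mkseq.
have size_b : size (mkseq b n) == n by rewrite size_mkseq.
have hv j : (j <= n)%N -> height (Tuple size_v) j = g j by apply: height_mkseq.
have g_b j : (j < n)%N -> (~~ t j)%:Z <= b j <= g j.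
  move=> lt_j; rewrite /t /b /g lt_j /shift.
  set i := (n - j.+1)%N; have lt_i : (i < n)%N by rewrite /i; lia.
  have -> : (j.+1 == n.+1 - m)%N = (i.+1 == m) by rewrite /i; lia.
  (* Colour and height get the same correction, which preserves the upper bound. For the lower one,
     raised colours become at least 1, and colours after the critical step were at least 1
     already. *)
  have := hc i lt_i; have := c_gt i lt_i; rewrite -/(h i) -/(w i).
  have [i_crit|i_crit] := eqVneq i.+1 m; last by case: (up (w i)) => /=; lia.
  have -> : up (w i) by rewrite (_ : i = m.-1) //; lia.
  by rewrite -i_crit ltnn /=; lia.
have lagV : is_laguerre (Tuple size_v, Tuple size_b).
  apply/is_laguerreP; split=> [i le_i||i lt_i].
  (* Heights are nonnegative because they bound nonnegative colours. *)
  + rewrite hv //; have [lt_i|ge_i] := ltnP i n; first by have := g_b i lt_i; lia.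
    by rewrite /g ltnNge ge_i.
  + by rewrite hv // /g ltnn.
  + by rewrite hv ?(ltnW lt_i) //= !nth_mkseq // up_v; apply: g_b.
pose V := Laguerre lagV.
have stepV (j : 'I_n) : lstep V j = v j.
  by rewrite /lstep (tnth_nth StepE) /= nth_mkseq.
have colV (j : 'I_n) : lcol V j = b j.
  by rewrite /lcol (tnth_nth 0) /= nth_mkseq.
have heightV (j : 'I_n) : lheight V j = h (rev_ord j) + shift (rev_ord j).
  by rewrite /lheight hv 1?ltnW // /g ltn_ord.
have lt_p : (n - m < n)%N by lia.
exists V; split=> [|j j_crit|j|j].
- rewrite (cs_eq V (Ordinal lt_p)) /=; first by lia.
    by rewrite colV /b /shift /= (_ : n - (n - m).+1 = m.-1)%N ?c_crit ?w_crit; lia.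
  (* Later positions mirror those before the critical step: up letters there have their colour
     raised to at least 1, and down letters already had that. *)
  move=> j /= lt_j; rewrite colV /b /shift; set i := (n - j.+1)%N.
  have [lt_i i_crit] : (i < n)%N /\ (i.+1 < m)%N.
    by have := ltn_ord j; rewrite /i; lia.
  have := hc i lt_i; rewrite -/(w i) i_crit ltnNge ltnW //=.
  by case: (up (w i)) => /=; lia.
- rewrite -[_ \in _]/(up _) stepV up_v downE /t /lstep (tnth_nth StepE) -/m.
  by move/eqP/negPf: j_crit => ->.
- rewrite !downE -!/(up _) stepV up_v heightV /t /shift -/m.
  rewrite /lheight -/(h _) /=; set i := (n - j.+1)%N.
  have lt_j := ltn_ord j.
  have -> : (j.+1 == n.+1 - m)%N = (i.+1 == m) by rewrite /i; lia.
  have -> : (n.+1 - m < j.+1)%N = (i.+1 < m)%N by rewrite /i; lia.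
  have -> : (j.+1 < n.+1 - m)%N = (m < i.+1)%N by rewrite /i; lia.
  by case: ltngtP => /= _; case: (up (w i)) => /=; lia.
- by rewrite colV heightV /b /lcol (tnth_nth 0) /lheight -/(h _) /=; lia.
Qed.

(* The position n + 1 - j of [n], for j = i.+1, is (rev_ord i).+1. *)
Theorem theorem3p2 (n : nat) (n_ge1 : (1 <= n)%N) :
  exists! xi : laguerre n -> laguerre n,
    involutive xi /\
    forall (W V : laguerre n) (m : nat), cs W = m -> V = xi W ->
      [/\ cs V = (n.+1 - m)%N,
          forall j : 'I_n, j.+1 <> (n.+1 - m)%N ->
            (lstep V j \in [:: StepN; StepE] <->
             lstep W (rev_ord j) \in [:: StepS; StepdE]),
          forall j : 'I_n, lheight V j =
            if (n.+1 - m < j.+1)%N && (lstep V j \in [:: StepS; StepdE])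
            then lheight W (rev_ord j) + 1
            else if (j.+1 < n.+1 - m)%N && (lstep V j \in [:: StepN; StepE])
            then lheight W (rev_ord j) - 1
            else lheight W (rev_ord j)
        & forall j : 'I_n,
            lcol V j = lheight V j - lheight W (rev_ord j) + lcol W (rev_ord j)].
Proof.
pose xi W := sval (mirror_exists W n_ge1).
have xiP W : mirror W (xi W) by rewrite /xi; case: mirror_exists.
exists xi; split; first split.
(* Both [xi (xi W)] and, by symmetry, [W] are mirrors of [xi W]. *)
- by move=> W; apply: (mirror_uniq (xi W)) => //; apply: mirror_sym.
- by move=> W V _ <- ->; apply: xiP.
- move=> xi' [_ xi'P]; apply: functional_extensionality => W.
  by apply: (mirror_uniq W) => //; apply: xi'P.
Qed.
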